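(* Fix $\lambda>0$ and let $p_n=\lambda/n$. Let $(k_n)_{n\in\mathbb N}$ be such that $\lim_{n\to\infty}k_n/\log n=\infty$ and $k_n\le n$. Then there is a constant $C>0$ such that, for $n$ large enough, $$-\tfrac13k_n\log(\tfrac13k_n)-Ck_n\le\log\mathbb P(V_T(G_{n,p_n})\ge k_n)\le-\tfrac13k_n\log(\tfrac13k_n)+Ck_n.$$
   Context: $G_{n,p}$ is the Erdős–Rényi random graph on $[n]=\{1,\dots,n\}$: each edge is present independently with probability $p$; its law is $\mathbb P$. For a graph $G$, $V_T(G)$ is the number of vertices of $G$ that are part of a triangle. *)

(* Defs.v *)
From mathcomp Require Import all_boot all_order all_algebra.
From mathcomp Require Import all_classical all_reals all_analysis.

Set Implicit Arguments.
Unset Strict Implicit.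
Unset Printing Implicit Defensive.

Import Order.TTheory GRing.Theory Num.Theory.
Import numFieldNormedType.Exports.

Local Open Scope ring_scope.

(* The vertex set [n] is 'I_n; a potential edge is an unordered pair of
   distinct vertices, and a simple graph is its set of edges. *)
Definition vpair (n : nat) := {e : {set 'I_n} | #|e| == 2%N}.

Definition graph (n : nat) := {set vpair n}.

(* Irreflexive because [set x; x] has cardinal 1. *)
Definition adj (n : nat) (G : graph n) : rel 'I_n :=
  fun x y => [exists e in G, val e == [set x; y]%SET].

Definition in_triangle (n : nat) (G : graph n) (x : 'I_n) : bool :=
  [exists y, [exists z, [&& adj G x y, adj G y z & adj G z x]]].

Definition VT (n : nat) (G : graph n) : nat :=
  #|[set x | in_triangle G x]%SET|.

(* For 0 <= p <= 1 this is the law of G_{n,p}, i.e. the product Bernoulli(p)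
   law on the indicators of the potential edges. *)
Definition gnp_weight (R : realType) (n : nat) (p : R) (G : graph n) : R :=
  \prod_(e : vpair n) (if e \in G then p else 1 - p).

Definition gnp_prob (R : realType) (n : nat) (p : R) (A : pred (graph n)) : R :=
  \sum_(G : graph n | A G) gnp_weight p G.

Lemma adj_irr (n : nat) (G : graph n) : irreflexive (adj G).
Proof.
move=> x; apply/negbTE/negP => /exists_inP[e _ /eqP exx].
by have := valP e; rewrite /= exx finset.setUid cards1.
Qed.

Lemma gnp_probT (R : realType) (n : nat) (p : R) :
  gnp_prob p (predT : pred (graph n)) = 1.
Proof.
rewrite /gnp_prob /gnp_weight.
transitivity (\prod_(e : vpair n) (p + (1 - p))).
  by rewrite bigA_distr; apply: eq_bigl => G; rewrite inE.
by rewrite big1 // => e _; rewrite addrC subrK.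
Qed.

(* Main.v *)
(* Upper bound: take a minimal family of triangles covering all the vertices
   that lie in a triangle.  It has at least [k / 3] members, each of which has a
   private vertex, so if [t >= k / 3] every ordering of [t] of its members is a
   sequence in which each triangle has a vertex outside the previous ones.  A
   triangle with a new vertex has at most one edge in common with the previous
   ones, so adding it multiplies the expected number of such sequences by at
   most [(n p)^3 + 3 (n p)^2], whence
   [P (VT >= k) <= ((n p)^3 + 3 (n p)^2)^t / t!].

   Lower bound: count sequences of [m = floor (k / 3)] disjoint triangles in
   graphs with at most [2 m] triangles.  There are at most [(2 m)^m] of them in
   such a graph, so it suffices to bound their expected number from below: the
   triangles can be forced one after the other by resampling all the edges that
   touch them, each step creating only one triangle, and by Markov's inequality
   the unconditioned graph has at most [m] triangles with probability at least
   [1/2].  The rounding of [k / 3] is repaired by adding one triangle, at a cost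
   polynomial in [n], which is [exp (O (k))]. *)
Require Import Defs.
From mathcomp Require Import all_boot all_order all_algebra.
From mathcomp Require Import reals zify ring lra.

Set Implicit Arguments.
Unset Strict Implicit.
Unset Printing Implicit Defensive.

Import Order.TTheory GRing.Theory Num.Theory.

(** * Expectations over G(n,p) *)

Section GnpMean.
Local Open Scope ring_scope.
Context {R : realType} {n : nat}.
Variable p : R.
Implicit Types (G A B : graph n) (f g : graph n -> R) (e : vpair n).

Definition gnp_mean f : R := \sum_(G : graph n) gnp_weight p G * f G.

Lemma gnp_probE (A : pred (graph n)) :
  gnp_prob p A = gnp_mean (fun G => (A G)%:R).
Proof.
rewrite /gnp_prob big_mkcond; apply: eq_bigr => G _.
by case: (A G); rewrite ?mulr1 ?mulr0.
Qed.

Lemma gnp_mean_cst c : gnp_mean (fun=> c) = c.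
Proof.
rewrite /gnp_mean -mulr_suml -[RHS]mul1r; congr (_ * _).
by rewrite -(gnp_probT n p); apply: eq_bigl.
Qed.

Lemma eq_gnp_mean f g : f =1 g -> gnp_mean f = gnp_mean g.
Proof. by move=> fg; apply: eq_bigr => G _; rewrite fg. Qed.

Lemma gnp_mean_sum (I : finType) (P : pred I) (F : I -> graph n -> R) :
  gnp_mean (fun G => \sum_(i | P i) F i G) = \sum_(i | P i) gnp_mean (F i).
Proof.
by rewrite exchange_big; apply: eq_bigr => G _; rewrite mulr_sumr.
Qed.

Lemma gnp_meanZ c f : gnp_mean (fun G => c * f G) = c * gnp_mean f.
Proof. by rewrite mulr_sumr; apply: eq_bigr => G _; rewrite mulrCA. Qed.

(** * Conditioning on one edge and forcing sets of edges *)

Lemma sum_graph_edge e (g : graph n -> R) :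
  \sum_(G : graph n) g G = \sum_(G : graph n | e \notin G) (g G + g (e |: G)).
Proof.
rewrite big_split (bigID (fun G : graph n => e \in G)) /= addrC.
congr (_ + _).
rewrite (reindex_onto (fun G : graph n => e |: G) (fun G => G :\ e)) /=.
  apply: eq_bigl => G; rewrite setU11 /=.
  apply/eqP/idP => [<-|eG]; first by rewrite setD11.
  by rewrite setU1K.
by move=> G eG; rewrite setD1K.
Qed.

Lemma gnp_weight_edge e G : e \notin G ->
  let r := \prod_(a | a != e) (if a \in G then p else 1 - p) in
  gnp_weight p G = (1 - p) * r /\ gnp_weight p (e |: G) = p * r.
Proof.
move=> eG r; rewrite /gnp_weight; split; rewrite (bigD1 e) //=.
  by rewrite (negbTE eG).
rewrite setU11; congr (_ * _); apply: eq_bigr => a ae.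
by rewrite in_setU1 (negbTE ae).
Qed.

(** The state of [e] is independent of the other edges, so condition on it. Neither argument of [f]
    on the right depends on whether [e] lies in [G]. *)
Lemma gnp_mean_edge e f :
  gnp_mean f = p * gnp_mean (fun G => f (e |: G))
             + (1 - p) * gnp_mean (fun G => f (G :\ e)).
Proof.
rewrite -!gnp_meanZ /gnp_mean -big_split /=.
rewrite !(sum_graph_edge e); apply: eq_bigr => G eG.
have [-> ->] := gnp_weight_edge eG.
have -> : e |: (e |: G) = e |: G by rewrite setUA setUid.
have -> : G :\ e = G.
  by apply/setP => a; rewrite !inE; case: eqP => // ->; rewrite (negbTE eG).
rewrite setU1K //; ring.
Qed.

Hypotheses (p0 : 0 <= p) (p1 : p <= 1).

Lemma gnp_weight_ge0 G : 0 <= gnp_weight p G.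
Proof. by apply: prodr_ge0 => e _; case: ifP => // _; rewrite subr_ge0. Qed.

Lemma ler_gnp_mean f g : (forall G, f G <= g G) -> gnp_mean f <= gnp_mean g.
Proof.
by move=> fg; apply: ler_sum => G _; apply: ler_wpM2l; rewrite ?gnp_weight_ge0.
Qed.

Lemma gnp_mean_ge0 f : (forall G, 0 <= f G) -> 0 <= gnp_mean f.
Proof. by move=> f0; rewrite -(gnp_mean_cst 0); apply: ler_gnp_mean. Qed.

(** As [f] is nonnegative, conditioning on each edge of [A] in turn and dropping the term where it
    is absent only loses mass. The induction is over all [f], since forcing [e] replaces [f] by its
    composition with the addition of [e]. *)
Lemma gnp_mean_setU A f : (forall G, 0 <= f G) ->
  p ^+ #|A| * gnp_mean (fun G => f (A :|: G)) <= gnp_mean f.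
Proof.
elim: {A}#|A| {-2}A (erefl #|A|) f => [|k IH] A Ak f f0.
  rewrite Ak mul1r (cards0_eq Ak); apply: ler_gnp_mean => G.
  by rewrite set0U.
have /card_gt0P[e eA] : (0 < #|A|)%N by rewrite Ak.
have Aek : #|A :\ e| = k by move: (cardsD1 e A); rewrite eA Ak => -[].
rewrite (gnp_mean_edge e f) -[leLHS]addr0; apply: lerD.
  rewrite Ak exprS -mulrA; apply: ler_wpM2l => //.
  apply: le_trans (IH _ Aek (fun G => f (e |: G)) _) => [|G]; last exact: f0.
  rewrite Aek; apply/ler_wpM2l; first exact: exprn_ge0.
  by apply: ler_gnp_mean => G; rewrite setUA setD1K.
by rewrite mulr_ge0 ?subr_ge0 // gnp_mean_ge0.
Qed.

Lemma gnp_mean_setD B f : (forall G, 0 <= f G) ->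
  (1 - p) ^+ #|B| * gnp_mean (fun G => f (G :\: B)) <= gnp_mean f.
Proof.
elim: {B}#|B| {-2}B (erefl #|B|) f => [|k IH] B Bk f f0.
  rewrite Bk mul1r (cards0_eq Bk); apply: ler_gnp_mean => G.
  by rewrite setD0.
have /card_gt0P[e eB] : (0 < #|B|)%N by rewrite Bk.
have Bek : #|B :\ e| = k by move: (cardsD1 e B); rewrite eB Bk => -[].
rewrite (gnp_mean_edge e f) -[leLHS]add0r; apply: lerD.
  by rewrite mulr_ge0 // gnp_mean_ge0.
rewrite Bk exprS -mulrA; apply: ler_wpM2l; first by rewrite subr_ge0.
apply: le_trans (IH _ Bek (fun G => f (G :\ e)) _) => [|G]; last exact: f0.
rewrite Bek; apply/ler_wpM2l; first by rewrite exprn_ge0 // subr_ge0.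
by apply: ler_gnp_mean => G; rewrite setDDl setUC setD1K.
Qed.

Lemma gnp_mean_sub A : gnp_mean (fun G => (A \subset G)%:R) = p ^+ #|A|.
Proof.
elim: {A}#|A| {-2}A (erefl #|A|) => [|k IH] A Ak.
  rewrite Ak (cards0_eq Ak) -[RHS](gnp_mean_cst 1); apply: eq_gnp_mean => G.
  by rewrite sub0set.
have /card_gt0P[e eA] : (0 < #|A|)%N by rewrite Ak.
have Aek : #|A :\ e| = k by move: (cardsD1 e A); rewrite eA Ak => -[].
rewrite (gnp_mean_edge e) [X in _ + _ * X](_ : _ = 0) ?mulr0 ?addr0.
  rewrite Ak exprS -Aek -(IH _ Aek); congr (_ * _); apply: eq_gnp_mean => G.
  by rewrite subDset.
rewrite -[RHS](gnp_mean_cst 0); apply: eq_gnp_mean => G.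
by case: subsetP => // /(_ e eA); rewrite setD11.
Qed.

End GnpMean.

(** * Triangles *)

Section Triangles.
Context {n : nat}.
Implicit Types (G H : graph n) (T U : {set 'I_n}) (e : vpair n).

Definition inner_edges T : graph n := [set e : vpair n | val e \subset T].

Definition touching_edges T : graph n :=
  [set e : vpair n | ~~ [disjoint val e & T]].

(** A triangle is encoded by its vertex set, so that it counts once whatever the order of its
    vertices, and covers and packings are families of sets. *)
Definition triangles G : {set {set 'I_n}} :=
  [set T : {set 'I_n} | (#|T| == 3) && (inner_edges T \subset G)].

Lemma card_vpair e : #|val e| = 2.
Proof. by apply/eqP; exact: (valP e). Qed.

Lemma card_inner_edges T : #|T| = 3 -> #|inner_edges T| = 3.
Proof.
move=> T3; rewrite -(card_imset _ val_inj).
rewrite -[RHS]/'C(3, 2) -T3 -cards_draws; congr #|pred_of_set _|.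
apply/setP => A; rewrite inE; apply/imsetP/andP => [[e]|[AT A2]].
  by rewrite inE => eT ->; rewrite card_vpair.
by exists (Sub A A2); rewrite ?inE SubK.
Qed.

(** Such an edge is given by an end in [T] and another vertex. With [p] of order [1 / n], the
    absence of all these edges costs only a constant factor. *)
Lemma card_touching_edges T : (#|touching_edges T| <= #|T| * n)%N.
Proof.
rewrite -(card_imset _ val_inj) -[X in (_ * X)%N]card_ord -cardsT -cardsX.
pose h (u : 'I_n * 'I_n) := [set u.1; u.2].
apply: leq_trans (leq_imset_card h _); apply/subset_leq_card/subsetP => A.
case/imsetP => e; rewrite inE disjoint_subset => /subsetPn[x xe].
rewrite inE negbK => xT ->.
have /cards1P[y ey] : #|val e :\ x| == 1%N.
  by move: (cardsD1 x (val e)); rewrite xe card_vpair; lia.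
apply/imsetP; exists (x, y); first by rewrite !inE xT.
by rewrite /h /= -ey setD1K.
Qed.

Lemma inner_edges_adj G T x y :
  inner_edges T \subset G -> x \in T -> y \in T -> x != y -> adj G x y.
Proof.
move=> TG xT yT xy.
have e2 : #|[set x; y]| == 2 by rewrite cards2 xy.
apply/exists_inP; exists (Sub [set x; y] e2); last by rewrite SubK.
by apply: (subsetP TG); rewrite inE SubK subUset !sub1set xT.
Qed.

Lemma in_triangleE G x : in_triangle G x = (x \in cover (triangles G)).
Proof.
apply/idP/bigcupP => [/existsP[y /existsP[z /and3P[axy ayz azx]]]|[T]].
  have neq u v : adj G u v -> u != v.
    by apply: contraTneq => ->; rewrite adj_irr.
  exists [set x; y; z]; last by rewrite !inE eqxx.
  have T3 : #|[set x; y; z]| == 3.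
    by rewrite setUC cardsU1 !inE cards2 negb_or (neq _ _ axy) (neq _ _ azx)
      (eq_sym z y) (neq _ _ ayz).
  rewrite inE T3 /=; apply/subsetP => e; rewrite inE => eT.
  (* An edge inside the triple misses exactly one of the three vertices, [w]. The value of [w] tells
     which of the three adjacencies puts [e] in [G]. *)
  have /cards1P[w Tw] : #|[set x; y; z] :\: val e| == 1%N.
    by rewrite cardsD (eqP T3) (setIidPr eT) card_vpair.
  have eE : val e = [set x; y; z] :\ w.
    by rewrite -Tw setDDr setDv set0U (setIidPr eT).
  have adjE u v : adj G u v -> val e = [set u; v] -> e \in G.
    move=> /exists_inP[a aG /eqP ae] ee.
    by have /val_inj-> : val e = val a by rewrite ee.
  have wT : w \in [set x; y; z].
    have : w \in [set x; y; z] :\: val e by rewrite Tw set11.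
    by rewrite in_setD => /andP[].
  have [[xy yz] zx] := (neq _ _ axy, neq _ _ ayz, neq _ _ azx).
  move: wT; rewrite !inE -orbA => /or3P[] /eqP wE; rewrite wE in eE.
  - apply: (adjE y z ayz); rewrite eE; apply/setP => u; rewrite !inE.
    by case: (u =P x) => // ->; rewrite (negbTE xy) eq_sym (negbTE zx).
  - apply: (adjE z x azx); rewrite eE; apply/setP => u; rewrite !inE.
    case: (u =P y) => [->|]; last by rewrite orbF orbC.
    by rewrite (negbTE yz) eq_sym (negbTE xy).
  - apply: (adjE x y axy); rewrite eE; apply/setP => u; rewrite !inE.
    case: (u =P z) => [->|]; last by rewrite orbF.
    by rewrite (negbTE zx) eq_sym (negbTE yz).
rewrite inE => /andP[/eqP T3 TG] xT.
have : #|T :\ x| == 2 by move: (cardsD1 x T); rewrite xT T3 add1n => -[<-].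
case/cards2P => y [z [yz Tyz]].
have [yT zT] : y \in T :\ x /\ z \in T :\ x by rewrite Tyz !inE !eqxx orbT.
move: yT zT; rewrite !inE => /andP[yx yT] /andP[zx zT].
apply/existsP; exists y; apply/existsP; exists z.
by rewrite !(inner_edges_adj TG) // eq_sym.
Qed.

Lemma VT_cover G : VT G = #|cover (triangles G)|.
Proof.
by congr #|pred_of_set _|; apply/setP => x; rewrite inE in_triangleE.
Qed.

Lemma triangles_mono G H : G \subset H -> triangles G \subset triangles H.
Proof.
move=> GH; apply/subsetP => T; rewrite !inE => /andP[-> TG].
exact: subset_trans GH.
Qed.

(** The third vertex determines the triple. *)
Lemma card_triangle_at_edge e :
  (#|[set T : {set 'I_n} | (#|T| == 3) && (val e \subset T)]| <= n)%N.
Proof.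
rewrite -[X in (_ <= X)%N]card_ord -cardsT.
apply: leq_trans (leq_imset_card (fun w => w |: val e) _).
apply/subset_leq_card/subsetP => T; rewrite inE => /andP[/eqP T3 eT].
have /cards1P[w Tw] : #|T :\: val e| == 1%N.
  by rewrite cardsD T3 (setIidPr eT) card_vpair.
apply/imsetP; exists w => //; rewrite -Tw setUC.
by rewrite -{1}(setIidPr eT) setID.
Qed.

(** The result of resampling the edges that touch [T]: its three inner edges are present and all
    others are absent, so a triple [T] becomes a component. *)
Definition isolate T G : graph n :=
  inner_edges T :|: (G :\: touching_edges T).

Lemma isolate_disjoint G T U : [disjoint U & T] ->
  U \in triangles G -> U \in triangles (isolate T G).
Proof.
move=> UT; rewrite !inE => /andP[-> /subsetP UG] /=.
apply/subsetP => e eU; rewrite !inE UG // andbT.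
move: eU; rewrite inE => eU.
by rewrite negbK (disjointWl eU UT) orbT.
Qed.

(** Only [T] itself can be new: a triangle that meets the component [T] is [T], and one disjoint
    from it uses only edges of [G]. *)
Lemma card_triangles_isolate G T : #|T| = 3 ->
  (#|triangles (isolate T G)| <= #|triangles G|.+1)%N.
Proof.
move=> T3; apply: leq_trans (_ : #|T |: triangles G| <= _)%N; last first.
  by rewrite cardsU1; case: (T \notin _).
apply/subset_leq_card/subsetP => U; rewrite !inE => /andP[/eqP U3 UG].
have [->//|UT /=] := eqVneq U T; rewrite U3 eqxx /=.
have [/subsetP UsT|] := boolP (U \subset T).
  by case/negP: UT; rewrite eqEcard U3 T3 leqnn andbT; apply/subsetP.
case/subsetPn => v vU vT.
(* A common vertex [u] would give the edge [uv] of [U], which touches [T] without lying inside it,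
   and [isolate] has deleted that edge. *)
have dUT : [disjoint U & T].
  apply/pred0P => u /=; apply/negP => /andP[uU uT].
  have uv : u != v by apply: contraNneq vT => <-.
  have e2 : #|[set u; v]| == 2 by rewrite cards2 uv.
  have : Sub [set u; v] e2 \in inner_edges U.
    by rewrite inE SubK subUset !sub1set uU.
  move/(subsetP UG); rewrite !inE SubK subUset !sub1set uT (negbTE vT) /=.
  rewrite negbK => /andP[/pred0P/(_ u)/=]; rewrite !inE eqxx uT //.
apply/subsetP => e eU; have := subsetP UG _ eU; rewrite !inE.
case/orP => [eT|/andP[]//]; move: eU; rewrite inE => eU.
have /card_gt0P[x xe] : (0 < #|val e|)%N by rewrite card_vpair.
by move/pred0P: dUT => /(_ x) /=; rewrite (subsetP eU) ?(subsetP eT).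
Qed.

Lemma card_3sets : (#|[set T : {set 'I_n} | #|T| == 3]| <= n ^ 3)%N.
Proof.
rewrite card_draws card_ord; apply: (@leq_trans (n ^_ 3)).
  by rewrite -bin_ffact leq_pmulr.
rewrite !ffactnS ffactn0 muln1 !expnS expn0 muln1.
by apply: leq_mul => //; apply: leq_mul; lia.
Qed.

(** An edge of [T] that lies inside [U] avoids the new vertex [w], so it can only be [T :\ w]. *)
Lemma card_innerI_le1 (E : graph n) T U :
    #|T| = 3 -> ~~ (T \subset U) -> {in E, forall e, val e \subset U} ->
  (#|inner_edges T :&: E| <= 1)%N.
Proof.
move=> T3 /subsetPn[w wT wU] EU; apply/card_le1_eqP => a b.
suff vE e : e \in inner_edges T :&: E -> val e = T :\ w.
  by move=> /vE aE /vE bE; apply: val_inj; rewrite aE bE.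
rewrite !inE => /andP[eT eE]; apply/eqP; rewrite eqEcard card_vpair.
have -> : #|T :\ w| = 2 by move: (cardsD1 w T); rewrite wT T3 => -[].
rewrite leqnn andbT; apply/subsetP => x xe; rewrite !inE.
rewrite (subsetP eT) // andbT; apply: contraNneq wU => <-.
exact: (subsetP (EU e eE)).
Qed.

End Triangles.

(** * Upper bound *)

Section CoverCount.
Context {n : nat}.
Implicit Types (G E : graph n) (T U : {set 'I_n}) (P : {set {set 'I_n}}).

(** Counts the sequences of [t] triangles in which each has a vertex outside [U] and all the
    previous ones. *)
Fixpoint cover_count G t U : nat :=
  if t is t'.+1 then
    \sum_(T in triangles G | ~~ (T \subset U)) cover_count G t' (U :|: T)
  else 1.

(* Every ordering of a family with private vertices is counted. *)
Lemma fact_le_cover_count G t P U :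
    P \subset triangles G ->
    {in P, forall T, ~~ (T \subset U :|: cover (P :\ T))} ->
  t <= #|P| -> t`! <= cover_count G t U.
Proof.
elim: t P U => [//|t IH] P U PG priv tP /=.
rewrite (bigID (mem P)) /=; apply: leq_trans (leq_addr _ _).
rewrite (eq_bigl (mem P)) => [|T]; last first.
  apply/andP/idP => [[]//|TP]; split=> //; rewrite (subsetP PG) //=.
  apply: contra (priv T TP) => TU; exact: subset_trans TU (subsetUl _ _).
(* Any member [T] of [P] may come first. The private vertices of the other members lie outside [T],
   so [P :\ T] satisfies the hypotheses for [U :|: T]. *)
apply: leq_trans (_ : \sum_(T in P) t`! <= _); last first.
  apply: leq_sum => T TP; apply: (IH (P :\ T)).
  - exact: subset_trans (subsetDl _ _) PG.
  - move=> T' /setD1P[T'T T'P]; apply: contra (priv T' T'P) => sub.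
    apply: subset_trans sub _; rewrite -setUA setUS //.
    rewrite subUset bigcup_sup ?inE ?(eq_sym T) ?T'T //=.
    apply/bigcupsP => T2; rewrite !inE => /and3P[h1 h2 h3].
    by rewrite bigcup_sup // !inE h1.
  - by move: (cardsD1 T P) tP; rewrite TP => ->; rewrite add1n.
by rewrite sum_nat_const factS leq_mul2r tP orbT.
Qed.

(** A minimal subfamily with the same cover works: a member without a private vertex could be
    removed. *)
Lemma private_cover G : exists P,
  [/\ P \subset triangles G, VT G <= 3 * #|P| &
      {in P, forall T, ~~ (T \subset cover (P :\ T))}].
Proof.
pose covers (Q : {set {set 'I_n}}) :=
  (Q \subset triangles G) && (cover Q == cover (triangles G)).
have [|P /minsetP[/andP[PG /eqP cP] Pmin] _] :=
    @minset_exists _ covers (triangles G).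
  by rewrite /covers eqxx subxx.
exists P; split => //.
  rewrite VT_cover -cP mulnC -sum_nat_const.
  apply: leq_trans (leq_card_cover P) _.
  apply: leq_sum => T /(subsetP PG); rewrite inE => /andP[/eqP -> //].
move=> T TP; apply/negP => sub.
have : P :\ T = P.
  apply: Pmin; last exact: subsetDl.
  rewrite /covers (subset_trans (subsetDl _ _) PG) /= -cP eqEsubset.
  apply/andP; split; apply/bigcupsP => T2.
    by rewrite inE => /andP[_ T2P]; rewrite bigcup_sup.
  move=> T2P; have [->//|T2T] := eqVneq T2 T.
  by rewrite bigcup_sup // !inE T2T.
by move/setP/(_ T); rewrite !inE eqxx TP.
Qed.

Local Open Scope ring_scope.

(** A triangle that shares no edge with [E] costs [p ^+ 3], and there are at most [n ^ 3] of them.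
    One that shares an edge costs [p ^+ 2]; there are at most [3 * n] edges to share and [n] third
    vertices for each. *)
Lemma sum_new_edges (R : realType) (p : R) E U :
    0 <= p -> p <= 1 -> {in E, forall e : vpair n, val e \subset U} ->
    (#|E| <= 3 * n)%N ->
  \sum_(T : {set 'I_n} | (#|T| == 3%N) && ~~ (T \subset U))
     p ^+ #|E :|: inner_edges T|
  <= p ^+ #|E| * ((n%:R * p) ^+ 3 + 3%:R * (n%:R * p) ^+ 2).
Proof.
move=> p0 p1 EU En.
pose i T := #|inner_edges T :&: E|.
(* Since [i T] is 0 or 1, [p ^+ (3 - i T)] is at most [p ^+ 3 + (i T)%:R * p ^+ 2]; the bound is
   linear in [i T]. *)
apply: (@le_trans _ _ (p ^+ #|E| *
    \sum_(T : {set 'I_n} | #|T| == 3%N) (p ^+ 3 + (i T)%:R * p ^+ 2))).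
  rewrite big_distrr /= big_mkcondr /=; apply: ler_sum => T /eqP T3.
  case: ifPn => [TU|_]; last by rewrite mulr_ge0 ?addr_ge0 ?mulr_ge0 ?exprn_ge0.
  have i1 := card_innerI_le1 T3 TU EU.
  have -> : #|E :|: inner_edges T| = (#|E| + (3 - i T))%N.
    rewrite cardsU card_inner_edges // setIC -/(i T).
    by move: i1; rewrite -/(i T); lia.
  rewrite exprD ler_wpM2l ?exprn_ge0 //.
  move: i1; rewrite -/(i T); case: (i T) => [|[|//]] _.
    by rewrite mul0r addr0.
  by rewrite mul1r lerDr exprn_ge0.
rewrite ler_wpM2l ?exprn_ge0 // big_split /= !exprMn; apply: lerD.
  rewrite sumr_const -[X in X <= _]mulr_natl ler_wpM2r ?exprn_ge0 //.
  by rewrite -natrX ler_nat; move: (@card_3sets n); rewrite cardsE.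
rewrite -mulr_suml [leRHS]mulrA ler_wpM2r ?exprn_ge0 //.
rewrite -natr_sum -natrX -natrM ler_nat.
apply: (@leq_trans (\sum_(e in E) n)); last first.
  by rewrite sum_nat_const expnS expn1; nia.
(* Double counting of the pairs formed by an edge of [E] and a triple containing it. *)
rewrite (eq_bigr (fun T => \sum_(e in E | val e \subset T) 1)%N); last first.
  by move=> T _; rewrite sum1_card; apply: eq_card => e; rewrite !inE andbC.
rewrite (exchange_big_dep (fun e => e \in E)) /=; last by move=> T e _ /andP[].
apply: leq_sum => e eE; rewrite sum1_card.
apply: leq_trans (card_triangle_at_edge e); apply/subset_leq_card/subsetP => T.
by rewrite unfold_in [in X in _ -> X]inE => /andP[-> /andP[_ ->]].
Qed.

(** [E] collects the edges of the triangles chosen so far and [U] contains their vertices. The bound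
    on [#|E| + 3 * t] is preserved when a triangle is added, and it keeps [#|E|] below [3 * n] as
    [sum_new_edges] requires. *)
Lemma gnp_mean_cover_count (R : realType) (p : R) t E U :
    0 <= p -> p <= 1 -> {in E, forall e : vpair n, val e \subset U} ->
    (#|E| + 3 * t <= 3 * n)%N ->
  gnp_mean p (fun G => (E \subset G)%:R * (cover_count G t U)%:R) <=
  p ^+ #|E| * ((n%:R * p) ^+ 3 + 3%:R * (n%:R * p) ^+ 2) ^+ t.
Proof.
move=> p0 p1; elim: t E U => [|t IH] E U EU En /=.
  rewrite mulr1 -gnp_mean_sub; apply: ler_gnp_mean => // G; by rewrite mulr1.
set C := (_ + _) in IH *.
have C0 : 0 <= C by rewrite addr_ge0 ?mulr_ge0 ?exprn_ge0 ?mulr_ge0.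
(* The event that [T] is a triangle of [G] is absorbed into the set of forced edges, so the range of
   the sum no longer depends on [G]. *)
rewrite (@eq_gnp_mean _ _ _ _ (fun G =>
    \sum_(T : {set 'I_n} | (#|T| == 3%N) && ~~ (T \subset U))
    (E :|: inner_edges T \subset G)%:R * (cover_count G t (U :|: T))%:R)); last first.
  move=> G; rewrite natr_sum big_distrr /= big_mkcond [RHS]big_mkcond /=.
  apply: eq_bigr => T _; rewrite inE subUset.
  by case: (#|T| == 3%N) (T \subset U) (inner_edges T \subset G) (E \subset G)
    => [] [] [] [] //=; rewrite ?mul0r.
rewrite gnp_mean_sum exprS [leRHS]mulrA.
apply: (@le_trans _ _ (\sum_(T : {set 'I_n} | (#|T| == 3%N) && ~~ (T \subset U))
     p ^+ #|E :|: inner_edges T| * C ^+ t)).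
  apply: ler_sum => T /andP[/eqP T3 _]; apply: IH.
    move=> e; rewrite inE => /orP[/EU eU|].
      exact: subset_trans (subsetUl _ _).
    by rewrite inE => eT; apply: subset_trans (subsetUr _ _).
  have [] := leq_card_setU E (inner_edges T).
  by rewrite card_inner_edges // => cE _; lia.
rewrite -mulr_suml ler_wpM2r ?exprn_ge0 // sum_new_edges //; lia.
Qed.

(** Markov's inequality for [cover_count]. The [+ 2] is the rounding: [3 * t <= VT G + 2] and
    [VT G <= 3 * #|P|] still give [t <= #|P|]. *)
Lemma gnp_prob_VT_le (R : realType) (p : R) t :
    0 <= p -> p <= 1 -> (t <= n)%N ->
  gnp_prob p (fun G => 3 * t <= VT G + 2)%N * t`!%:R <=
  ((n%:R * p) ^+ 3 + 3%:R * (n%:R * p) ^+ 2) ^+ t.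
Proof.
move=> p0 p1 tn; rewrite gnp_probE mulrC -gnp_meanZ.
have E0 : {in set0, forall e : vpair n, val e \subset set0}.
  by move=> e; rewrite inE.
have tn3 : (#|@set0 (vpair n)| + 3 * t <= 3 * n)%N.
  by rewrite cards0 leq_mul2l tn orbT.
have := gnp_mean_cover_count p0 p1 E0 tn3; rewrite cards0 mul1r.
apply: le_trans.
apply: ler_gnp_mean => // G; rewrite sub0set mul1r.
case: leqP => [tV|_]; last by rewrite mulr0.
rewrite mulr1 ler_nat; have [P [PG VP priv]] := private_cover G.
apply: (fact_le_cover_count PG) => [T TP|]; first by rewrite set0U priv.
lia.
Qed.

End CoverCount.

(** * Lower bound *)

Section PackingCount.
Context {n : nat}.
Implicit Types (G : graph n) (T U : {set 'I_n}).

(** Counts the sequences of [m] pairwise disjoint triangles that avoid [U]. *)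
Fixpoint packing_count G m U : nat :=
  if m is m'.+1 then
    \sum_(T in triangles G | [disjoint T & U]) packing_count G m' (U :|: T)
  else 1.

Lemma packing_count_le G m U : packing_count G m U <= #|triangles G| ^ m.
Proof.
elim: m U => [//|m IH] U /=.
apply: leq_trans
  (_ : \sum_(T in triangles G | [disjoint T & U]) #|triangles G| ^ m <= _).
  exact: leq_sum.
rewrite sum_nat_const expnS leq_mul2r; apply/orP; right.
by apply/subset_leq_card/subsetP => T; rewrite unfold_in => /andP[].
Qed.

Lemma packing_count_cover G m U :
  0 < packing_count G m U -> 3 * m <= #|cover (triangles G) :\: U|.
Proof.
elim: m U => [//|m IH] U /=; rewrite lt0n sum_nat_eq0.
case/forallPn => T; rewrite negb_imply -lt0n => /andP[/andP[TG TU] /IH mT].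
have T3 : #|T| = 3 by move: TG; rewrite inE => /andP[/eqP].
have TC : T \subset cover (triangles G) :\: U.
  apply/subsetP => x xT; rewrite !inE (disjointFr TU) //=.
  by apply/bigcupP; exists T.
have := cardsD (cover (triangles G) :\: U) T.
rewrite (setIidPr TC) setDDl T3 => cT.
move: (subset_leq_card TC) mT; rewrite cT T3 => T3c mT.
by rewrite mulnS -leq_subRL.
Qed.

Lemma packing_count_isolate G T m U : T \subset U ->
  packing_count G m U <= packing_count (isolate T G) m U.
Proof.
elim: m U => [//|m IH] U TU /=.
rewrite big_mkcond [leqRHS]big_mkcond /=; apply: leq_sum => V _.
case: ifPn => // /andP[VG VU]; rewrite isolate_disjoint ?VU //=; last first.
  exact: disjointWr VU.
by apply: IH; apply: subset_trans TU (subsetUl _ _).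
Qed.

(** From [N - 1 >= 2 * N / 3] and [N - 2 >= N / 3], with equality at [N = 3]. *)
Lemma bin3_ge N : 3 <= N -> N ^ 3 <= 27 * 'C(N, 3).
Proof.
move=> N3; rewrite -(@leq_pmul2r 3`!) // -mulnA bin_ffact.
rewrite !ffactnS ffactn0 muln1 !expnS expn0 muln1 (_ : 3`! = 6) //.
by case: N N3 => [|[|[|N]]] // _ /=; nia.
Qed.

(** Holds factor by factor: [3 * m <= n] gives [n * (m - i) <= (n - 3 * i) * m], to be cubed and
    combined with [bin3_ge]. Even for [3 * m] close to [n], the loss against [n ^ (3 * m)] is only
    exponential in [m]. *)
Lemma prod_bin3_ge m : 3 * m <= n ->
  n ^ (3 * m) * m`! ^ 3 <= (3 * m) ^ (3 * m) * \prod_(i < m) 'C(n - 3 * i, 3).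
Proof.
move=> mn; have prodX a : a ^ (3 * m) = \prod_(i < m) a ^ 3.
  by rewrite prod_nat_const card_ord expnM.
have -> : m`! ^ 3 = \prod_(i < m) (m - i) ^ 3.
  by rewrite -ffactnn ffact_prod !expnS expn0 muln1 -!big_split;
     apply: eq_bigr => i _; rewrite !expnS expn0 muln1.
rewrite !prodX -!big_split /=; apply: leq_prod => i _.
have im := ltn_ord i.
rewrite -expnMn [leqRHS](_ : _ = 27 * 'C(n - 3 * i, 3) * m ^ 3); last first.
  by rewrite expnMn mulnAC.
have N3 : 3 <= n - 3 * i by lia.
apply: leq_trans (_ : (n - 3 * i) ^ 3 * m ^ 3 <= _); last first.
  by rewrite leq_mul2r bin3_ge ?orbT.
by rewrite -expnMn leq_exp2r //; nia.
Qed.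

Local Open Scope ring_scope.
Variables (R : realType) (p : R).
Hypotheses (p0 : 0 <= p) (p1 : p <= 1).

Lemma gnp_mean_isolate T (f : graph n -> R) :
    #|T| = 3%N -> (forall G, 0 <= f G) ->
  p ^+ 3 * (1 - p) ^+ (3 * n) * gnp_mean p (fun G => f (isolate T G))
  <= gnp_mean p f.
Proof.
move=> T3 f0; have q0 : 0 <= 1 - p by rewrite subr_ge0.
apply: le_trans (gnp_mean_setU p0 p1 (inner_edges T) f0).
rewrite card_inner_edges // -mulrA ler_wpM2l ?exprn_ge0 //.
apply: le_trans (gnp_mean_setD p0 p1 (touching_edges T) _); last by [].
rewrite ler_wpM2r ?gnp_mean_ge0 // ler_wiXn2l ?gerBl //.
by rewrite -T3 card_touching_edges.
Qed.

(** Each step chooses a triple [T] off [U] and isolates it, at cost [p ^+ 3 * (1 - p) ^+ (3 * n)].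
    It creates at most one triangle, so the cap grows from [Q] to [Q + m] over [m] steps. *)
Lemma gnp_mean_packing_count_ge Q m U :
  (\prod_(i < m) 'C(n - #|U| - 3 * i, 3))%:R *
    (p ^+ 3 * (1 - p) ^+ (3 * n)) ^+ m *
    gnp_prob p (fun G => #|triangles G| <= Q)%N <=
  gnp_mean p (fun G : graph n =>
    (#|triangles G| <= Q + m)%N%:R * (packing_count G m U)%:R).
Proof.
move Eq : (p ^+ 3 * (1 - p) ^+ (3 * n)) => q.
have q0 : 0 <= q by rewrite -Eq mulr_ge0 ?exprn_ge0 ?subr_ge0.
elim: m U => [|m IH] U.
  rewrite big_ord0 !mul1r gnp_probE addn0; apply: ler_gnp_mean => // G.
  by rewrite mulr1.
rewrite (@eq_gnp_mean _ _ _ _ (fun G : graph n =>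
    \sum_(T : {set 'I_n} | (#|T| == 3%N) && [disjoint T & U])
    ((#|triangles G| <= Q + m.+1)%N && (inner_edges T \subset G))%:R *
    (packing_count G m (U :|: T))%:R)); last first.
  move=> G /=; rewrite natr_sum big_distrr /= big_mkcond [RHS]big_mkcond /=.
  apply: eq_bigr => T _; rewrite inE.
  by case: (#|T| == 3%N) [disjoint T & U] (inner_edges T \subset G) (_ <= _)%N
    => [] [] [] [] //=; rewrite ?mul0r.
rewrite gnp_mean_sum big_ord_recl muln0 subn0 natrM exprS.
have <- : #|[set T : {set 'I_n} | (#|T| == 3%N) && [disjoint T & U]]| =
    'C(n - #|U|, 3).
  have <- : #|~: U| = (n - #|U|)%N by rewrite cardsCs setCK card_ord.
  rewrite -cards_draws; apply: eq_card => T; rewrite !inE andbC.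
  by rewrite disjoints_subset.
rewrite -!mulrA mulr_natl -sumr_const big_mkcond [leRHS]big_mkcond /=.
apply: ler_sum => T _; rewrite inE; case: ifP => // /andP[/eqP T3 TU].
apply: le_trans (gnp_mean_isolate T3 _); last by move=> G; rewrite mulr_ge0.
rewrite Eq [leLHS]mulrCA; apply: ler_wpM2l => //.
(* As [T] has three vertices off [U], the factor of index [i] for [U :|: T] is that of index [i + 1]
   for [U]. *)
rewrite mulrA; apply: le_trans (le_trans _ (IH (U :|: T))) _.
  rewrite le_eqVlt; apply/orP; left; apply/eqP; congr (_%:R * _ * _).
  apply: eq_bigr => i _; congr 'C(_, 3).
  rewrite cardsU setIC (disjoint_setI0 TU) cards0 T3.
  by rewrite /bump /=; lia.
apply: ler_gnp_mean => // G.
have [XG|] := leqP #|triangles G| (Q + m); last by rewrite mul0r mulr_ge0.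
rewrite mul1r (_ : _ && _); last first.
  rewrite (leq_trans (card_triangles_isolate G T3)) ?addnS //=.
  exact: subsetUl.
by rewrite mul1r ler_nat packing_count_isolate ?subsetUr.
Qed.

(** * The total number of triangles, and the resulting lower bound *)

Lemma gnp_mean_triangles :
  gnp_mean p (fun G : graph n => #|triangles G|%:R) <= (n%:R * p) ^+ 3.
Proof.
rewrite (@eq_gnp_mean _ _ _ _ (fun G : graph n =>
    \sum_(T : {set 'I_n} | #|T| == 3%N) (inner_edges T \subset G)%:R)); last first.
  move=> G; rewrite -sum1_card natr_sum big_mkcond [RHS]big_mkcond /=.
  by apply: eq_bigr => T _; rewrite inE; case: (_ == _); case: (_ \subset _).
rewrite gnp_mean_sum (eq_bigr (fun=> p ^+ 3)); last first.
  by move=> T /eqP T3; rewrite gnp_mean_sub // card_inner_edges.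
rewrite sumr_const exprMn -[X in X <= _]mulr_natl ler_wpM2r ?exprn_ge0 //.
by rewrite -natrX ler_nat; move: (@card_3sets n); rewrite cardsE.
Qed.

Lemma gnp_prob_few_triangles m :
  m.+1%:R * (1 - gnp_prob p (fun G : graph n => #|triangles G| <= m)%N)
  <= (n%:R * p) ^+ 3.
Proof.
apply: le_trans gnp_mean_triangles.
rewrite gnp_probE mulrBr mulr1 lerBlDr -gnp_meanZ.
rewrite -{1}(gnp_mean_cst (n := n) p m.+1%:R).
rewrite /gnp_mean -big_split /=; apply: ler_sum => G _; rewrite -mulrDr.
rewrite ler_wpM2l ?gnp_weight_ge0 //; case: leqP => Gm.
  by rewrite mulr1 lerDr.
by rewrite mulr0 addr0 ler_nat.
Qed.

(** Start with [Q = m] and no used vertices. Under the cap [2 * m] there are at most [(2 * m) ^ m]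
    packings, and none unless [3 * m <= VT G]. *)
Lemma gnp_prob_VT_ge m : (3 * m <= n)%N ->
  (\prod_(i < m) 'C(n - 3 * i, 3))%:R *
    (p ^+ 3 * (1 - p) ^+ (3 * n)) ^+ m *
    gnp_prob p (fun G : graph n => #|triangles G| <= m)%N
  <= (2 * m)%:R ^+ m * gnp_prob p (fun G : graph n => 3 * m <= VT G)%N.
Proof.
move=> mn; have := gnp_mean_packing_count_ge m m set0.
rewrite cards0 subn0 => /le_trans -> //.
rewrite gnp_probE -gnp_meanZ; apply: ler_gnp_mean => // G.
rewrite -natrX addnn -mul2n.
have [Gm|_] := leqP #|triangles G| (2 * m); last by rewrite mul0r mulr_ge0.
rewrite mul1r -natrM ler_nat.
have [->//|/packing_count_cover] := posnP (packing_count G m set0).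
rewrite setD0 -VT_cover => ->; rewrite muln1.
apply: leq_trans (packing_count_le _ _ _) _.
by case: (m) Gm => // k; rewrite leq_exp2r.
Qed.

(** * Gaining three vertices by one additional triangle *)

Lemma VT_setU_inner G T : #|T| = 3%N ->
  (#|cover (triangles G) :|: T| <= VT (inner_edges T :|: G))%N.
Proof.
move=> T3; rewrite VT_cover; apply: subset_leq_card; rewrite subUset.
apply/andP; split.
  apply/bigcupsP => S SG; apply: bigcup_sup.
  exact: (subsetP (triangles_mono (subsetUr _ _))).
by apply: bigcup_sup; rewrite inE T3 eqxx subsetUl.
Qed.

Lemma cover_3more (S : {set 'I_n}) K :
    (K <= n)%N -> (3 <= n)%N -> (K <= #|S| + 3)%N ->
  exists2 T : {set 'I_n}, #|T| = 3%N & (K <= #|S :|: T|)%N.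
Proof.
move=> Kn n3 KS.
have subk (A : {set 'I_n}) k : (k <= #|A|)%N ->
    exists2 B : {set 'I_n}, B \subset A & #|B| = k.
  move=> kA.
  have : (0 < #|[set B : {set 'I_n} | (B \subset A) && (#|B| == k)]|)%N.
    by rewrite cards_draws bin_gt0.
  by case/card_gt0P => B; rewrite inE => /andP[BA /eqP Bk]; exists B.
have Sn : (#|S| + #|~: S| = n)%N by rewrite cardsC card_ord.
have [c3|c3] := leqP 3 #|~: S|.
  have [T TS T3] := subk _ _ c3; exists T => //.
  rewrite cardsU T3 (_ : S :&: T = set0) ?cards0 ?subn0 //.
  apply/eqP; rewrite -subset0 -(setICr S) setIS //.
have [B BS Bk] : exists2 B : {set 'I_n}, B \subset S & #|B| = (3 - #|~: S|)%N.
  by apply: subk; lia.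
(* With fewer than three vertices left outside [S], take them all and fill up from [S]; the union is
   then the whole vertex set. *)
exists (~: S :|: B).
  rewrite cardsU Bk (_ : ~: S :&: B = set0) ?cards0; first lia.
  by apply/eqP; rewrite -subset0 -(setICr S) setIC setSI.
by rewrite setUA setUCr setTU cardsT card_ord.
Qed.

(** A union bound over the at most [n ^ 3] triples that can be added; forcing one of them costs
    [p ^+ 3]. *)
Lemma gnp_prob_VT_3more K : (K <= n)%N -> (3 <= n)%N ->
  p ^+ 3 * gnp_prob p (fun G : graph n => K <= VT G + 3)%N <=
  n%:R ^+ 3 * gnp_prob p (fun G : graph n => K <= VT G)%N.
Proof.
move=> Kn n3; rewrite !gnp_probE.
apply: (@le_trans _ _ (\sum_(T : {set 'I_n} | #|T| == 3%N)
   p ^+ 3 * gnp_mean p (fun G : graph n =>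
     (K <= VT (inner_edges T :|: G))%N%:R))).
  rewrite -big_distrr /= -gnp_mean_sum ler_wpM2l ?exprn_ge0 //.
  apply: ler_gnp_mean => // G; case: leqP => [KG|_]; last exact: sumr_ge0.
  rewrite VT_cover in KG; have [T T3 KT] := cover_3more Kn n3 KG.
  rewrite (bigD1 T) ?T3 //= (leq_trans KT (VT_setU_inner _ T3)) lerDl.
  exact: sumr_ge0.
set P := gnp_mean p _.
apply: (@le_trans _ _ (\sum_(T : {set 'I_n} | #|T| == 3%N) P)).
  apply: ler_sum => T /eqP T3; rewrite -(card_inner_edges T3).
  exact: (gnp_mean_setU p0 p1 _ (f := fun G : graph n => (K <= VT G)%N%:R)).
rewrite sumr_const -[leLHS]mulr_natl ler_wpM2r ?gnp_mean_ge0 //.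
by rewrite -natrX ler_nat; move: (@card_3sets n); rewrite cardsE.
Qed.

End PackingCount.

(** * Asymptotics *)

From mathcomp Require Import all_classical all_reals all_analysis.
Import numFieldNormedType.Exports.
Local Open Scope classical_set_scope.
Local Open Scope ring_scope.

Section Asymptotics.
Context {R : realType}.
Implicit Types (lambda k x : R).

(* From [(1 + 1 / m)^m <= e], by induction. *)
Lemma natX_le_expR_fact m : (m%:R : R) ^+ m <= expR m%:R * m`!%:R.
Proof.
elim: m => [|m IH]; first by rewrite expR0 mulr1.
rewrite exprS factS natrM mulrCA ler_wpM2l //.
have [->|m0] := posnP m.
  by rewrite mulr1 (le_trans _ (expR_ge1Dx _)) // lerDl.
have mR : (m%:R : R) != 0 by rewrite pnatr_eq0 -lt0n.
have -> : (m.+1%:R : R) = m%:R * (1 + m%:R^-1).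
  by rewrite mulrDr mulr1 divff // natr1.
rewrite exprMn [in leRHS]mulrDr mulr1 divff // expRD mulrAC.
apply: ler_pM => //.
apply: (@le_trans _ _ (expR m%:R^-1 ^+ m)).
  by rewrite lerXn2r ?nnegrE ?expR_ge0 ?addr_ge0 ?expR_ge1Dx.
by rewrite -expRM_natl divff.
Qed.

(** For [x] in this range, [(1 - x) * (1 + 2 * x) >= 1]. *)
Lemma expR_le_onem x : 0 <= x -> 2 * x <= 1 -> expR (- (2 * x)) <= 1 - x.
Proof.
move=> x0 x1; have e1 : 1 + 2 * x <= expR (2 * x) := expR_ge1Dx _.
rewrite expRN; apply: (@le_trans _ _ (1 + 2 * x)^-1).
  by rewrite lef_pV2 ?posrE ?expR_gt0 //; lra.
by rewrite -[leLHS]mul1r ler_pdivrMr; nra.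
Qed.

(** In the constant, [expR (- 6 * lambda)] bounds [(1 - p) ^+ (3 * n)], [expR (- 3)] comes from the
    cube of [m!], and 54 is 27 from the binomials times 2 from [(2 * m) ^ m]. The last factor
    [1 / 2] is the probability of few triangles. *)
Lemma gnp_prob_VT_lower n lambda m : 0 < lambda -> (0 < n)%N ->
    2 * lambda <= n%:R -> 2 * lambda ^+ 3 <= m.+1%:R -> (0 < m)%N ->
    (3 * m <= n)%N ->
  (lambda ^+ 3 * expR (- (6 * lambda + 3)) / 54 / m%:R) ^+ m / 2 <=
  gnp_prob (lambda / n%:R) (fun G : graph n => 3 * m <= VT G)%N.
Proof.
move=> l0 n0 ln2 lm m0 mn.
have nR : 0 < (n%:R : R) by rewrite ltr0n.
have mR : 0 < (m%:R : R) by rewrite ltr0n.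
set p := lambda / n%:R.
have p0 : 0 <= p by rewrite divr_ge0 // ltW.
have p2 : 2 * p <= 1 by rewrite mulrA ler_pdivrMr // mul1r.
have p1 : p <= 1 by lra.
have np : n%:R * p = lambda by rewrite mulrCA divff ?mulr1 // gt_eqF.
have few : 1 / 2 <= gnp_prob p (fun G : graph n => #|triangles G| <= m)%N.
  have := gnp_prob_few_triangles (n := n) p0 p1 m; rewrite np => h.
  have m1 : 0 < (m.+1%:R : R) by rewrite ltr0n.
  set P := gnp_prob _ _ in h *; nra.
have H := gnp_prob_VT_ge p0 p1 mn.
set P := gnp_prob p (fun G : graph n => 3 * m <= VT G)%N in H *.
have P0 : 0 <= P by rewrite /P gnp_probE gnp_mean_ge0.
have bin3 : (n%:R : R) ^+ (3 * m) * m`!%:R ^+ 3 <=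
    (3 * m)%:R ^+ (3 * m) * (\prod_(i < m) 'C(n - 3 * i, 3))%:R.
  by rewrite -!natrX -!natrM ler_nat prod_bin3_ge.
have fact3 : (m%:R : R) ^+ (3 * m) <= expR 3 ^+ m * m`!%:R ^+ 3.
  rewrite mulnC exprM (_ : expR 3 ^+ m = expR m%:R ^+ 3); last first.
    by rewrite -!expRM_natl mulrC.
  rewrite -exprMn lerXn2r ?nnegrE ?exprn_ge0 ?mulr_ge0 ?expR_ge0 //.
  exact: natX_le_expR_fact.
have q1 : expR (- (6 * lambda)) <= (1 - p) ^+ (3 * n).
  have -> : - (6 * lambda) = (3 * n)%:R * - (2 * p) by rewrite -np natrM; ring.
  rewrite expRM_natl lerXn2r ?nnegrE ?expR_ge0 ?expR_le_onem //; lra.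
set B := (\prod_(i < m) _)%:R in H bin3.
have B0 : 0 <= B by rewrite ler0n.
set F := (m`!%:R : R) in bin3 fact3.
have F0 : 0 <= F by rewrite ler0n.
set q := p ^+ 3 * (1 - p) ^+ (3 * n) in H.
have q0 : 0 <= q by rewrite mulr_ge0 ?exprn_ge0 // subr_ge0.
have cq : lambda ^+ 3 * expR (- (6 * lambda)) <= n%:R ^+ 3 * q.
  by rewrite /q mulrA -exprMn np ler_wpM2l ?exprn_ge0 // ltW.
rewrite opprD expRD (expRN 3) mulrA; set c := lambda ^+ 3 * _ in cq *.
have c0 : 0 <= c by rewrite mulr_ge0 ?expR_ge0 ?exprn_ge0 // ltW.
clearbody c q B F; have cqm : c ^+ m <= n%:R ^+ (3 * m) * q ^+ m.
  by rewrite exprM -exprMn lerXn2r ?nnegrE ?mulr_ge0 ?exprn_ge0.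
have m3 : 0 < (m%:R : R) ^+ (3 * m) by rewrite exprn_gt0.
(* After multiplication by [m ^ (3 * m)], the bounds [cqm], [fact3] and [bin3] eliminate [n] and the
   factorial. *)
have cB : c ^+ m <= expR 3 ^+ m * 27 ^+ m * (B * q ^+ m).
  rewrite -(ler_pM2r m3).
  apply: (@le_trans _ _
    (n%:R ^+ (3 * m) * q ^+ m * (expR 3 ^+ m * F ^+ 3))).
    by apply: ler_pM => //; rewrite exprn_ge0 // ltW.
  rewrite [leLHS]
    (_ : _ = q ^+ m * expR 3 ^+ m * (n%:R ^+ (3 * m) * F ^+ 3)); last by ring.
  rewrite [leRHS]
    (_ : _ = q ^+ m * expR 3 ^+ m * ((3 * m)%:R ^+ (3 * m) * B)).
    by rewrite ler_wpM2l ?mulr_ge0 ?exprn_ge0 ?expR_ge0.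
  rewrite natrM exprMn [3 ^+ (3 * m)]exprM (_ : 3%:R ^+ 3 = 27 :> R); last by ring.
  ring.
have Bq : B * q ^+ m / 2 <= (2 * m)%:R ^+ m * P.
  apply: le_trans H; rewrite ler_wpM2l ?mulr_ge0 ?exprn_ge0 //; lra.
rewrite !exprMn !exprVn -!mulrA -!invfM ler_pdivrMr; last first.
  by rewrite !mulr_gt0 ?exprn_gt0 ?expR_gt0.
apply: (@le_trans _ _ (expR 3 ^+ m * 27 ^+ m * (2 * (B * q ^+ m / 2)))).
  by rewrite (_ : 2 * (B * q ^+ m / 2) = B * q ^+ m) //; field.
have -> : P * (expR 3 ^+ m * (54 ^+ m * (m%:R ^+ m * 2))) =
    expR 3 ^+ m * 27 ^+ m * (2 * ((2 * m)%:R ^+ m * P)).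
  rewrite natrM (_ : 54 = 27 * 2 :> R) ?exprMn; last by ring.
  ring.
by rewrite ler_wpM2l ?ler_wpM2l ?mulr_ge0 ?exprn_ge0 ?expR_ge0.
Qed.

Lemma nat_threshold (k : R) n : k <= n%:R ->
  exists2 K : nat, (K <= n)%N & forall v : nat, (k <= v%:R) = (K <= v)%N.
Proof.
move=> kn; pose Q v := k <= (v%:R : R).
have [K QK minK] := @ex_minnP Q (ex_intro _ n kn).
exists K; first exact: minK.
move=> v; apply/idP/idP => [/minK//|Kv]; apply: le_trans QK _.
by rewrite ler_nat.
Qed.

Lemma eq_gnp_prob n (p : R) (A B : pred (graph n)) :
  A =1 B -> gnp_prob p A = gnp_prob p B.
Proof. exact: eq_bigl. Qed.

Lemma le_gnp_prob n (p : R) (A B : pred (graph n)) : 0 <= p -> p <= 1 ->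
  (forall G, A G -> B G) -> gnp_prob p A <= gnp_prob p B.
Proof.
move=> p0 p1 AB; rewrite !gnp_probE; apply: ler_gnp_mean => // G.
by rewrite ler_nat; case: (A G) (AB G) => // ->.
Qed.

Lemma ler_xlnx (x y : R) : 1 <= x -> x <= y -> x * ln x <= y * ln y.
Proof.
move=> x1 xy; have x0 : 0 < x by apply: lt_le_trans x1.
have y0 : 0 < y by apply: lt_le_trans xy.
by rewrite ler_pM ?ln_ge0 ?ler_ln ?posrE // ltW.
Qed.

(** Take [m] the floor of [k / 3] and add one triangle. This costs the factor [p ^+ 3 / n ^+ 3],
    that is [lambda ^+ 3 / n ^+ 6], whose logarithm is absorbed by [ln n <= k]; hence the 6 and
    [3 * |ln lambda|] in the constant. *)
Lemma lne_VT_ge n lambda k : 0 < lambda -> (3 <= n)%N ->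
    2 * lambda <= n%:R -> 6 * lambda ^+ 3 <= k -> 3 <= k -> ln n%:R <= k ->
    k <= n%:R ->
  ((- (3^-1 * k * ln (3^-1 * k))
    - (`|ln (lambda ^+ 3 * expR (- (6 * lambda + 3)) / 54)|
       + 3 * `|ln lambda| + ln 2 + 6) * k)%:E <=
  lne (gnp_prob (lambda / n%:R) (fun G : graph n => k <= (VT G)%:R))%:E)%E.
Proof.
move=> l0 n3 ln2 lk k3 lnk kn; set c := _ / 54.
have nR : 0 < (n%:R : R) by rewrite ltr0n; apply: leq_trans n3.
have c0 : 0 < c by rewrite divr_gt0 // mulr_gt0 ?exprn_gt0 ?expR_gt0.
have [K Kn KE] := nat_threshold kn.
rewrite (@eq_gnp_prob _ _ _ (fun G => K <= VT G)%N) => [|G]; last exact: KE.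
set p := lambda / n%:R.
have p0 : 0 < p by rewrite divr_gt0.
have p1 : p <= 1 by rewrite ler_pdivrMr // mul1r; lra.
set m := Num.truncn (3^-1 * k).
have /andP[mk km] : m%:R <= 3^-1 * k < m.+1%:R by apply: truncn_itv; lra.
have m0 : (0 < m)%N by rewrite -ltnS -(ltr_nat R); lra.
have mn : (3 * m <= n)%N by rewrite -(ler_nat R) natrM; lra.
have Km : (K <= 3 * m + 3)%N.
  by move: km; rewrite -KE natrD natrM -[m.+1%:R]natr1; lra.
have mR : 0 < (m%:R : R) by rewrite ltr0n.
have lm : 2 * lambda ^+ 3 <= m.+1%:R by lra.
have H1 := gnp_prob_VT_lower l0 (ltn_trans (isT : 0 < 2)%N n3) ln2 lm m0 mn.
rewrite -/c in H1; clearbody c.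
have H2 := gnp_prob_VT_3more (ltW p0) p1 Kn n3.
have H3 : gnp_prob p (fun G : graph n => 3 * m <= VT G)%N <=
    gnp_prob p (fun G : graph n => K <= VT G + 3)%N.
  apply: le_gnp_prob (ltW p0) p1 _ => G mG.
  by apply: leq_trans Km _; rewrite leq_add2r.
set P := gnp_prob p (fun G : graph n => K <= VT G)%N in H2 *.
pose X := p ^+ 3 / n%:R ^+ 3 * ((c / m%:R) ^+ m / 2).
have cm0 : 0 < c / m%:R by rewrite divr_gt0.
have X0 : 0 < X by rewrite mulr_gt0 ?divr_gt0 ?exprn_gt0.
have XP : X <= P.
  rewrite /X mulrAC ler_pdivrMr ?exprn_gt0 // [leRHS]mulrC; apply: le_trans H2.
  by rewrite ler_wpM2l ?exprn_ge0 ?(ltW p0) // (le_trans H1).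
have P0 : 0 < P by apply: lt_le_trans XP.
rewrite lne_EFin // lee_fin; apply: (@le_trans _ _ (ln X)); last first.
  by rewrite ler_ln ?posrE.
have -> : ln X =
    3 * ln lambda - 6 * ln n%:R + m%:R * ln c - m%:R * ln m%:R - ln 2.
  rewrite /X lnM ?posrE ?divr_gt0 ?exprn_gt0 // ln_div ?posrE ?exprn_gt0 //.
  rewrite ln_div ?posrE ?exprn_gt0 // !lnXn // /p !ln_div ?posrE //.
  ring.
have xlnx : m%:R * ln m%:R <= 3^-1 * k * ln (3^-1 * k).
  by apply: ler_xlnx => //; rewrite ler1n.
have k1 : 1 <= k by lra.
have lam : - (3 * `|ln lambda| * k) <= 3 * ln lambda.
  have := ler_norm (- ln lambda); rewrite normrN => h1.
  have := normr_ge0 (ln lambda); nra.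
have cc : - (`|ln c| * k) <= m%:R * ln c.
  have := ler_norm (- ln c); rewrite normrN => h1.
  have := normr_ge0 (ln c); nra.
have l2 : 0 <= ln 2 :> R by rewrite ln_ge0 // ler1n.
have l2k : ln 2 <= ln 2 * k by nra.
lra.
Qed.

(** With [t] the ceiling of [K / 3], the bound [D ^+ t / t!] is at most [(e * D / t) ^+ t]. Then
    [t >= k / 3] controls [t * ln t], and [t <= k] controls the error term. *)
Lemma lne_VT_le n lambda k :
    0 < lambda -> lambda <= n%:R -> 3 <= k -> k <= n%:R ->
  (lne (gnp_prob (lambda / n%:R) (fun G : graph n => k <= (VT G)%:R))%:E <=
   (- (3^-1 * k * ln (3^-1 * k))
    + `|ln (expR 1 * (lambda ^+ 3 + 3 * lambda ^+ 2))| * k)%:E)%E.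
Proof.
move=> l0 ln1 k3 kn; set D := lambda ^+ 3 + _.
have nR : 0 < (n%:R : R) by lra.
have D0 : 0 < D by rewrite addr_gt0 ?mulr_gt0 ?exprn_gt0.
have [K Kn KE] := nat_threshold kn.
rewrite (@eq_gnp_prob _ _ _ (fun G => K <= VT G)%N) => [|G]; last exact: KE.
set p := lambda / n%:R.
have p0 : 0 <= p by rewrite divr_ge0 // ltW.
have p1 : p <= 1 by rewrite ler_pdivrMr // mul1r.
have np : n%:R * p = lambda by rewrite mulrCA divff ?mulr1 // gt_eqF.
pose t := ((K + 2) %/ 3)%N.
have Kt : (K <= 3 * t)%N by rewrite /t; lia.
have tK : (3 * t <= K + 2)%N by rewrite /t; lia.
have n3 : (3 <= n)%N by rewrite -(ler_nat R); lra.
have tn : (t <= n)%N by lia.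
have K3 : (2 < K)%N.
  by rewrite ltnNge -KE -ltNge; apply: lt_le_trans k3; rewrite ltr_nat.
have kt : 3^-1 * k <= t%:R by move: Kt; rewrite -KE natrM; lra.
have tk : t%:R <= k.
  have : (K.-1%:R : R) < k by rewrite ltNge KE; lia.
  have : (3 * t <= K.-1 + 3)%N by lia.
  by rewrite -(ler_nat R) natrM natrD; lra.
have := gnp_prob_VT_le p0 p1 tn; rewrite np -/D.
set P := gnp_prob p (fun G : graph n => K <= VT G)%N.
set P' := gnp_prob p _ => H.
have PP' : P <= P'.
  by apply: le_gnp_prob => // G KG; apply: leq_trans tK _; rewrite leq_add2r.
(* At a nonpositive argument [lne] is minus infinity, and the upper bound is immediate. *)
have [P0|P0] := leP P 0; first by rewrite /lne P0 leNye.
rewrite lne_EFin // lee_fin.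
have t0 : 0 < (t%:R : R) by lra.
have eD : 0 < expR 1 * D by rewrite mulr_gt0 ?expR_gt0.
have Pt : P * t%:R ^+ t <= (expR 1 * D) ^+ t.
  rewrite exprMn -expRM_natl mulr1.
  apply: (@le_trans _ _ (P' * (expR t%:R * t`!%:R))).
    apply: ler_pM => //; rewrite ?natX_le_expR_fact ?exprn_ge0 //.
    exact: ltW.
  by rewrite mulrCA ler_wpM2l ?expR_ge0.
have : ln (P * t%:R ^+ t) <= ln ((expR 1 * D) ^+ t).
  by rewrite ler_ln ?posrE ?mulr_gt0 ?exprn_gt0.
rewrite lnM ?posrE ?exprn_gt0 // !lnXn //.
rewrite -[ln t%:R *+ t]mulr_natl -[ln (_ * D) *+ t]mulr_natl => lnP.
have xlnx : 3^-1 * k * ln (3^-1 * k) <= t%:R * ln t%:R.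
  by apply: ler_xlnx => //; lra.
have := ler_norm (ln (expR 1 * D)); have := normr_ge0 (ln (expR 1 * D)).
move: lnP; set L := ln (expR 1 * D); nra.
Qed.

End Asymptotics.

(** * Combination of the two bounds for large [n] *)

Theorem theorem1p8 (R : realType) (lambda : R) (hlambda : 0 < lambda)
    (k : nat -> R)
    (hk : k n / ln (n%:R : R) @[n --> \oo] --> +oo)
    (hkn : forall n : nat, k n <= n%:R) :
  exists C : R, 0 < C /\
    \forall n \near \oo,
      let P := gnp_prob (lambda / n%:R)
                 (fun G : graph n => k n <= (VT G)%:R) in
      ((- (3^-1 * k n * ln (3^-1 * k n)) - C * k n)%:E <= lne P%:E)%E /\
      (lne P%:E <= (- (3^-1 * k n * ln (3^-1 * k n)) + C * k n)%:E)%E.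
Proof.
pose c := lambda ^+ 3 * expR (- (6 * lambda + 3)) / 54.
pose C1 : R := `|ln c| + 3 * `|ln lambda| + ln 2 + 6.
pose C2 := `|ln (expR 1 * (lambda ^+ 3 + 3 * lambda ^+ 2))|.
have C10 : 0 < C1 by rewrite ltr_wpDl // !addr_ge0 ?mulr_ge0 // ln_ge0 // ler1n.
have C20 : 0 <= C2 by exact: normr_ge0.
exists (C1 + C2); split; first by rewrite ltr_pwDl.
near=> n.
have n3 : (3 <= n)%N by near: n; exists 3%N.
have ln1 : 1 <= ln (n%:R : R).
  rewrite -[leLHS]expRK ler_ln ?posrE ?expR_gt0 ?ltr0n //; last first.
    by apply: leq_trans n3.
  by near: n; exact: nbhs_infty_ger.
(* The divergence of [k n / ln n] enters here: as [ln n >= 1], this one inequality yields all three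
   lower bounds on [k n]. *)
have lnk : Num.max 1 (Num.max 3 (6 * lambda ^+ 3)) * ln (n%:R : R) <= k n.
  rewrite -ler_pdivlMr; last by apply: lt_le_trans ln1.
  by near: n; move/cvgryPge : hk; exact.
have [lk k3 lk3] : [/\ ln (n%:R : R) <= k n, 3 <= k n & 6 * lambda ^+ 3 <= k n].
  move: lnk; rewrite !maxr_pMl; try lra.
  rewrite !ge_max mul1r => /and3P[? ? ?]; split => //; nra.
have ln2 : 2 * lambda <= n%:R by near: n; exact: nbhs_infty_ger.
have lower := lne_VT_ge hlambda n3 ln2 lk3 k3 lk (hkn n).
have ln1' : lambda <= n%:R by lra.
have upper := lne_VT_le hlambda ln1' k3 (hkn n).
split; [apply: le_trans lower | apply: le_trans upper _]; rewrite lee_fin.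
  rewrite lerD2l lerN2 ler_wpM2r //; first lra.
  by rewrite lerDl.
rewrite lerD2l ler_wpM2r //; first lra.
by rewrite lerDr ltW.
Unshelve. all: by end_near.
Qed.
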